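(* The group $V=\langle \tilde S\rangle$, where $\tilde S=\{\tilde x,\tilde y,\tilde z\}$, is a group of intermediate growth. Moreover, $V$ is locally isomorphic to $W$, in the following sense: let $S_1=\{a,b,c\}$ be a generating set of $W$ consisting of three involutions and let $S_{n+1}=(S_n)'$ for $n\ge 1$; then for any $R\in\mathbb{N}$ there is $n\in\mathbb{N}$ such that the balls $B_{V,\tilde S}(R)$ and $B_{W,S_n}(R)$ are isomorphic graphs, seen as subsets of the Cayley graphs of $V$ with respect to $\tilde S$ and of $W$ with respect to $S_n$.
   Context: Let $P=\{1,2,3,4,5,6,7\}$ (the projective plane over $\mathbb{F}_2$). Permutations act on the right. Let $x=(1,5)(3,7)$, $y=(2,3)(6,7)$, $z=(4,6)(5,7)$ be permutations of $P$, and let $A=\langle x,y,z\rangle\cong \mathrm{PSL}(3,2)$, acting on $P$. Let $P^*$ be the set of finite sequences over $P$. The group $A$ acts on $P^*$ by $(p_1p_2\dots p_n)a=(p_1a)p_2\dots p_n$ (fixing the empty sequence). An isomorphic copy $\overline{A}=\{\overline a: a\in A\}$ of $A$ acts on $P^*$ by $$(p_1\dots p_mp_{m+1}\dots p_n)\overline a=p_1\dots p_m(p_{m+1}a)p_{m+2}\dots p_n\quad\text{whenever } p_1=\dots=p_{m-1}=1,\ p_m=2,$$ for some $m\ge 1$ with $m<n$, and $\overline a$ fixes all sequences not of this form. The group $W$ is the group of permutations of $P^*$ generated by $A$ and $\overline A$. For permutations $g_1,\dots,g_7$ of $P^*$ and $a\in A$, write $g=\langle\!\langle g_1,\dots,g_7\rangle\!\rangle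 a$ for the permutation of $P^*$ given by $(p_1p_2\dots p_n)g=(p_1a)\big((p_2\dots p_n)g_{p_1}\big)$ (fixing the empty sequence). The permutations $\tilde x,\tilde y,\tilde z$ of $P^*$ are defined inductively by $$\tilde x=\langle\!\langle 1,1,1,\tilde x,1,1,1\rangle\!\rangle x,\quad \tilde y=\langle\!\langle \tilde y,1,1,1,1,1,1\rangle\!\rangle y,\quad \tilde z=\langle\!\langle 1,\tilde z,1,1,1,1,1\rangle\!\rangle z.$$ Given an (ordered) triple $S=\{a,b,c\}$ of involutions acting on $P^*$, define the triple $S'=\{a',b',c'\}$ of involutions by $$a'=\langle\!\langle 1,1,1,a,1,1,1\rangle\!\rangle x,\quad b'=\langle\!\langle b,1,1,1,1,1,1\rangle\!\rangle y,\quad c'=\langle\!\langle 1,c,1,1,1,1,1\rangle\!\rangle z.$$ A generating set $S_1$ of $W$ consisting of three involutions exists, and each $S_n$ then generates $W$. For a group $G$ generated by a finite set $S$, let $B_{G,S}(n)$ be the ball of radius $n$ in $G$ for the word metric induced by $S$ (elements that are products of at most $n$ elements of $S\cup S^{-1}$), and let $\lambda(G,S)=\lim_{n\to\infty}\sqrt[n]{\#B_{G,S}(n)}$ (the limit exists). $G$ has intermediate growth if $\lambda(G,S)=1$ and $\#B_{G,S}(n)$ is not bounded by any polynomial function of $n$. *)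

(* Defs.v *)
From HB Require Import structures.
From mathcomp Require Import all_boot all_order all_algebra all_fingroup.
From mathcomp Require Import finmap.
From mathcomp Require Import all_classical all_reals all_analysis.

Set Implicit Arguments.
Unset Strict Implicit.
Unset Printing Implicit Defensive.

Import Order.TTheory GRing.Theory Num.Theory.
Import numFieldNormedType.Exports.

Local Open Scope classical_set_scope.
Local Open Scope group_scope.

(* The library's {perm T} needs a finite T; this is the symmetric group of an
   arbitrary type, acting on the right: (g * h) u = h (g u). *)
Record symg (T : Type) := Symg {
  symg_fun :> T -> T;
  symg_inv : T -> T;
  symg_funK : cancel symg_fun symg_inv;
  symg_invK : cancel symg_inv symg_fun }.

Section SymGroup.
Variable T : Type.
Implicit Types g h : symg T.

Lemma symgP g h : g =1 h -> g = h.
Proof.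
case: g h => [f f' fK f'K] [k k' kK k'K] /= /funext fk.
rewrite -{}fk in kK k'K *.
have e : f' = k' by apply/funext => u; rewrite -{1}(k'K u) fK.
by rewrite -{}e in kK k'K *; congr Symg; apply: Prop_irrelevance.
Qed.

Definition symg_one : symg T := @Symg T id id (fun=> erefl) (fun=> erefl).
Definition symg_mul g h : symg T :=
  Symg (can_comp (symg_funK h) (symg_funK g))
       (can_comp (symg_invK g) (symg_invK h)).
Definition symg_V g : symg T := Symg (symg_invK g) (symg_funK g).

HB.instance Definition _ := gen_eqMixin (symg T).
HB.instance Definition _ := gen_choiceMixin (symg T).

Fact symg_mulA : associative symg_mul.
Proof. by move=> g h k; apply: symgP. Qed.
Fact symg_mul1 : left_id symg_one symg_mul.
Proof. by move=> g; apply: symgP. Qed.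
Fact symg_mulr1 : right_id symg_one symg_mul.
Proof. by move=> g; apply: symgP. Qed.
Fact symg_mulV : left_inverse symg_one symg_V symg_mul.
Proof. by move=> g; apply: symgP => u /=; rewrite symg_invK. Qed.
Fact symg_mulrV : right_inverse symg_one symg_V symg_mul.
Proof. by move=> g; apply: symgP => u /=; rewrite symg_funK. Qed.

HB.instance Definition _ :=
  isGroup.Build (symg T) symg_mulA symg_mul1 symg_mulr1 symg_mulV symg_mulrV.

End SymGroup.

Section Growth.
Variable gT : groupType.
Implicit Types (S G : set gT) (g h : gT) (n : nat).

Definition gen_subgroup S : set gT :=
  smallest [set H : set gT | group_closed [in H]] S.

Definition involution g : Prop := g != 1 /\ g * g = 1.

Definition sym_gens S : set gT := [set s | S s \/ S s^-1].

Definition word_ball S n : set gT :=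
  [set g | exists w : seq gT,
     [/\ (size w <= n)%N, forall s, s \in w -> sym_gens S s
       & g = \prod_(s <- w) s]].

(* For finite S every ball is finite, so fset_set does not hit its default. *)
Definition ball_card S n : nat := (#|` fset_set (word_ball S n)|)%N.

Definition cayley_adj S g h : Prop := exists2 s, sym_gens S s & h = g * s.

Definition intermediate_growth (R : realType) G S : Prop :=
  [/\ finite_set S, gen_subgroup S = G,
      (fun n => ((ball_card S n)%:R `^ n%:R^-1)%R) @ \oo --> (1%R : R)
    & ~ exists p : {poly R},
          forall n, ((ball_card S n)%:R <= p.[n%:R])%R].

End Growth.

Definition induced_graph_iso (U V : Type) (e : U -> U -> Prop) (A : set U)
    (e' : V -> V -> Prop) (B : set V) : Prop :=
  exists2 f : U -> V, set_bij A B f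
    & forall u v, A u -> A v -> (e u v <-> e' (f u) (f v)).

(* The points 1, ..., 7 are the ordinals of value 0, ..., 6. *)
Definition plane : finType := 'I_7.
Definition p1 : plane := @Ordinal 7 0 isT.
Definition p2 : plane := @Ordinal 7 1 isT.
Definition p3 : plane := @Ordinal 7 2 isT.
Definition p4 : plane := @Ordinal 7 3 isT.
Definition p5 : plane := @Ordinal 7 4 isT.
Definition p6 : plane := @Ordinal 7 5 isT.
Definition p7 : plane := @Ordinal 7 6 isT.

Definition perm_x : {perm plane} := tperm p1 p5 * tperm p3 p7.
Definition perm_y : {perm plane} := tperm p2 p3 * tperm p6 p7.
Definition perm_z : {perm plane} := tperm p4 p6 * tperm p5 p7.

Definition A_group : {group {perm plane}} :=
  <<[set perm_x; perm_y; perm_z]%SET>>%G.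

Definition head_fun (a : {perm plane}) (u : seq plane) : seq plane :=
  if u is p :: v then a p :: v else [::].

Fact head_funK a : cancel (head_fun a) (head_fun a^-1).
Proof. by case=> //= p v; rewrite permK. Qed.
Fact head_invK a : cancel (head_fun a^-1) (head_fun a).
Proof. by case=> //= p v; rewrite permKV. Qed.
Definition head_perm a : symg (seq plane) := Symg (head_funK a) (head_invK a).

Fixpoint bar_fun (a : {perm plane}) (u : seq plane) : seq plane :=
  if u is p :: v then
    p :: (if p == p1 then bar_fun a v
          else if p == p2 then head_fun a v else v)
  else [::].

Fact bar_funK a : cancel (bar_fun a) (bar_fun a^-1).
Proof.
elim=> //= p v IH; congr (_ :: _).
by case: eqP => // _; case: eqP => // _; apply: head_funK.
Qed.
Fact bar_invK a : cancel (bar_fun a^-1) (bar_fun a).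
Proof.
elim=> //= p v IH; congr (_ :: _).
by case: eqP => // _; case: eqP => // _; apply: head_invK.
Qed.
Definition bar_perm a : symg (seq plane) := Symg (bar_funK a) (bar_invK a).

Lemma bar_permE a k q v :
  bar_perm a (nseq k p1 ++ p2 :: q :: v) = nseq k p1 ++ p2 :: a q :: v.
Proof. by elim: k => //= k ->. Qed.

Lemma bar_perm_id a u :
  (forall k q v, u <> nseq k p1 ++ p2 :: q :: v) -> bar_perm a u = u.
Proof.
elim: u => //= p u IH Hu; congr (_ :: _); case: eqP => [e|_].
  by apply: IH => k q v E; apply: (Hu k.+1 q v); rewrite e E.
by case: eqP => // e; case: u Hu {IH} => // q v /(_ 0%N q v); rewrite e.
Qed.

Definition W_group : set (symg (seq plane)) :=
  gen_subgroup
    [set g | exists2 a, a \in A_group & g = head_perm a \/ g = bar_perm a].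

Section Branch.
Variables (g : plane -> symg (seq plane)) (a : {perm plane}).

Definition branch_fun (u : seq plane) : seq plane :=
  if u is p :: v then a p :: g p v else [::].
Definition branch_inv (u : seq plane) : seq plane :=
  if u is p :: v then a^-1 p :: symg_inv (g (a^-1 p)) v else [::].

Fact branch_funK : cancel branch_fun branch_inv.
Proof. by case=> //= p v; rewrite permK symg_funK. Qed.
Fact branch_invK : cancel branch_inv branch_fun.
Proof. by case=> //= p v; rewrite permKV symg_invK. Qed.

(* << g_1, ..., g_7 >> a *)
Definition branch : symg (seq plane) := Symg branch_funK branch_invK.
End Branch.

Definition single (p : plane) (g : symg (seq plane)) :
    plane -> symg (seq plane) :=
  fun q => if q == p then g else 1.

(* The permutation g with g = << 1, ..., g, ..., 1 >> a, g in position p; the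
   inductive definition is recursion on the sequence, see tilde_permE. *)
Section Tilde.
Variables (p : plane) (a : {perm plane}).

Fixpoint tilde_fun (u : seq plane) : seq plane :=
  if u is q :: v then a q :: (if q == p then tilde_fun v else v) else [::].
Fixpoint tilde_inv (u : seq plane) : seq plane :=
  if u is q :: v then
    a^-1 q :: (if a^-1 q == p then tilde_inv v else v)
  else [::].

Fact tilde_funK : cancel tilde_fun tilde_inv.
Proof. by elim=> //= q v IH; rewrite permK; case: eqP; rewrite ?IH. Qed.
Fact tilde_invK : cancel tilde_inv tilde_fun.
Proof. by elim=> //= q v IH; rewrite permKV; case: eqP; rewrite ?IH. Qed.
Definition tilde_perm : symg (seq plane) := Symg tilde_funK tilde_invK.

Lemma tilde_permE : tilde_perm = branch (single p tilde_perm) a.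
Proof. by apply: symgP; case=> //= q v; rewrite /single; case: eqP. Qed.
End Tilde.

Definition tilde_x : symg (seq plane) := tilde_perm p4 perm_x.
Definition tilde_y : symg (seq plane) := tilde_perm p1 perm_y.
Definition tilde_z : symg (seq plane) := tilde_perm p2 perm_z.

Definition triple : Type :=
  symg (seq plane) * symg (seq plane) * symg (seq plane).

Definition triple_set (t : triple) : set (symg (seq plane)) :=
  let: (a, b, c) := t in [set a; b; c].

Definition next_triple (t : triple) : triple :=
  let: (a, b, c) := t in
  (branch (single p4 a) perm_x,
   branch (single p1 b) perm_y,
   branch (single p2 c) perm_z).

(* S_1 = t and S_(n+1) = (S_n)'; the value at n = 0 is irrelevant. *)
Definition triple_seq (t : triple) (n : nat) : triple :=
  iter n.-1 next_triple t.

Definition tilde_S : set (symg (seq plane)) :=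
  triple_set (tilde_x, tilde_y, tilde_z).

Definition V_group : set (symg (seq plane)) := gen_subgroup tilde_S.

(* Main.v *)
Require Import Defs.
From mathcomp Require Import all_boot all_order all_algebra all_fingroup.
From mathcomp Require Import all_classical all_reals all_analysis.
From HB Require Import structures.
From mathcomp Require Import finmap.
From mathcomp Require Import zify lra ring.

Set Implicit Arguments.
Unset Strict Implicit.
Unset Printing Implicit Defensive.

Import Order.TTheory GRing.Theory Num.Theory.
Import numFieldNormedType.Exports.

(* A word w in the letters x, y, z acts on a sequence p u by moving p and then
   acting on u by the section of w at p, and every letter of w goes to exactly
   one of the seven sections. A section of a freely reduced word of length at
   least 2 is strictly shorter than the word. Hence after n levels the words of
   length at most n + 1 are decomposed into words of length at most 1, and are
   trivial in V if and only if they are trivial in W for S_(n+1): this is the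
   local isomorphism.

   Upper bound on the growth: the seven sections of a geodesic word w with d
   factors xyx, yzy or zxz have total reduced length at most |w| - d, and there
   are few words with small d. Let Z(v) be the sum of v^(-|g|) over g in V.
   Balancing both facts, Z(v) < oo implies Z(m) < oo for some m < v as long as
   v > 1, and m can be chosen uniformly smaller than v while v >= 1 + e.

   Lower bound: there are two substitutions of words of even length, one of
   which recovers a word in the section at 1, while the other has a trivial
   section at 1 and recovers a word in the section at 2. Thus
   #B(C n) >= (#B'(n))^2, where B' is the part of the ball made of the elements
   of even length, which gives 2^(2^k) elements in the ball of radius 2 * 24^k. *)

(** * Words and their sections *)

Inductive letter := X | Y | Z.

Definition ord_of_letter (s : letter) : 'I_3 :=
  match s with
  | X => @Ordinal 3 0 isT | Y => @Ordinal 3 1 isT | Z => @Ordinal 3 2 isT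
  end.
Definition letter_of_ord (i : 'I_3) : letter :=
  match val i with 0 => X | 1 => Y | _ => Z end.
Fact ord_of_letterK : cancel ord_of_letter letter_of_ord.
Proof. by case. Qed.

HB.instance Definition _ := Equality.copy letter (can_type ord_of_letterK).
HB.instance Definition _ := Choice.copy letter (can_type ord_of_letterK).
HB.instance Definition _ := Countable.copy letter (can_type ord_of_letterK).
HB.instance Definition _ := Finite.copy letter (can_type ord_of_letterK).

Definition letters : seq letter := [:: X; Y; Z].

Notation word := (seq letter).

Definition lpt (s : letter) : plane :=
  match s with X => p4 | Y => p1 | Z => p2 end.
Definition lperm (s : letter) : {perm plane} :=
  match s with X => perm_x | Y => perm_y | Z => perm_z end.

(* Permutations do not compute: swap2 and lact do. *)
Definition swap2 (a b c d p : plane) : plane :=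
  if p == a then b else if p == b then a else
  if p == c then d else if p == d then c else p.
Definition lact (s : letter) : plane -> plane :=
  match s with
  | X => swap2 p1 p5 p3 p7 | Y => swap2 p2 p3 p6 p7 | Z => swap2 p4 p6 p5 p7
  end.

Lemma lpermE s p : lperm s p = lact s p.
Proof.
by case: s; rewrite permM !permE /=; case: p => [[|[|[|[|[|[|[|?]]]]]]] ?] //=;
  apply/val_inj.
Qed.

Lemma lactK s : involutive (lact s).
Proof.
by case: s => [] [[|[|[|[|[|[|[|?]]]]]]] ?] //=; apply/val_inj.
Qed.

Lemma lact_lpt s : lact s (lpt s) = lpt s. Proof. by case: s; apply/val_inj. Qed.

(** The other letter whose permutation fixes [lpt s]; the third letter moves this point. *)
Definition nextl (s : letter) : letter :=
  match s with X => Y | Y => Z | Z => X end.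

Lemma lact_nextl s : lact (nextl s) (lpt s) = lpt s.
Proof. by case: s; apply/val_inj. Qed.

Lemma lpt_inj : injective lpt. Proof. by do 2!case. Qed.

Definition wact (w : word) (p : plane) : plane :=
  foldl (fun q s => lact s q) p w.

Fixpoint sec (w : word) (p : plane) : word :=
  if w is s :: v then
    (if p == lpt s then [:: s] else [::]) ++ sec v (lact s p)
  else [::].

Local Open Scope group_scope.

Definition tlet (t : triple) (s : letter) : symg (seq plane) :=
  let: (a, b, c) := t in match s with X => a | Y => b | Z => c end.
Definition ev (t : triple) (w : word) : symg (seq plane) :=
  \prod_(s <- w) tlet t s.

Definition tilde : triple := (tilde_x, tilde_y, tilde_z).

Definition good (t : triple) : Prop := forall s, involution (tlet t s).

Lemma symgE (g h : symg (seq plane)) u : (g * h) u = h (g u).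
Proof. by []. Qed.

Lemma ev_nil t : ev t [::] = 1. Proof. exact: big_nil. Qed.
Lemma ev_cons t s w : ev t (s :: w) = tlet t s * ev t w.
Proof. exact: big_cons. Qed.
Lemma ev_cat t w w' : ev t (w ++ w') = ev t w * ev t w'.
Proof. exact: big_cat. Qed.

Lemma tletV t s : good t -> (tlet t s)^-1 = tlet t s.
Proof.
move=> gt; have [_ /(congr1 (fun g => g * (tlet t s)^-1))] := gt s.
by rewrite mulgK mul1g.
Qed.

Lemma ev_rev t w : good t -> ev t (rev w) = (ev t w)^-1.
Proof.
move=> gt; elim: w => [|s w IH]; first by rewrite ev_nil invg1.
by rewrite rev_cons -cats1 ev_cat IH !ev_cons ev_nil mulg1 invgM tletV.
Qed.

Lemma tlet_next t s :
  tlet (next_triple t) s = branch (single (lpt s) (tlet t s)) (lperm s).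
Proof. by case: t => [[a b] c]; case: s. Qed.

(** Self-similarity of V: as a fixed point of [next_triple], [tilde] inherits every statement about
    [next_triple t]. *)
Lemma next_tilde : next_triple tilde = tilde.
Proof. by rewrite /next_triple /tilde /tilde_x /tilde_y /tilde_z -!tilde_permE. Qed.

Lemma ev_next_nil t w : ev (next_triple t) w [::] = [::].
Proof. by elim: w => [|s w IH]; rewrite ?ev_nil // ev_cons symgE tlet_next. Qed.

Lemma ev_next t w p v :
  ev (next_triple t) w (p :: v) = wact w p :: ev t (sec w p) v.
Proof.
elim: w p v => [|s w IH] p v; first by rewrite !ev_nil.
rewrite ev_cons symgE tlet_next /= lpermE IH /single.
by rewrite ev_cat; case: eqP; rewrite ?big_seq1 ?ev_cons ev_nil ?mulg1.
Qed.

Lemma ev_next_eq t w w' :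
  ev (next_triple t) w = ev (next_triple t) w' <->
  forall p, wact w p = wact w' p /\ ev t (sec w p) = ev t (sec w' p).
Proof.
split=> [e p|e]; last first.
  apply: symgP => -[|p v]; first by rewrite !ev_next_nil.
  by rewrite !ev_next; have [-> ->] := e p.
split; first by have := ev_next t w p [::]; rewrite e ev_next => -[].
by apply: symgP => v; have := ev_next t w p v; rewrite e ev_next => -[].
Qed.

(** A witness that a generator of the form [branch _ (lperm s)] differs from 1, whatever its
    sections are. *)
Definition moved (s : letter) : plane :=
  match s with X => p1 | Y => p2 | Z => p4 end.

Lemma lact_moved s : lact s (moved s) != moved s.
Proof. by case: s. Qed.

Lemma good_next t : good t -> good (next_triple t).
Proof.
move=> gt s; have [n1 sq] := gt s; split.
  apply/eqP => /(congr1 (fun g : symg (seq plane) => g [:: moved s])).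
  rewrite tlet_next /= lpermE => -[e].
  by have := lact_moved s; rewrite e eqxx.
apply: symgP => -[|p v]; first by rewrite symgE tlet_next.
(* The only nontrivial section sits at the fixed point [lpt s], where the square therefore has the
   square of [tlet t s] as its section. *)
rewrite symgE tlet_next /= !lpermE lactK /single (can2_eq (lactK s) (lactK s)).
by rewrite lact_lpt; case: eqP => // _; rewrite -symgE sq.
Qed.

Lemma good_iter n t : good t -> good (iter n next_triple t).
Proof. by move=> gt; elim: n => //= n IH; apply: good_next. Qed.

Lemma good_tilde : good tilde.
Proof.
move=> s; have e : tlet tilde s = branch (single (lpt s) (tlet tilde s)) (lperm s).
  by rewrite -tlet_next next_tilde.
split.
  apply/eqP => /(congr1 (fun g : symg (seq plane) => g [:: moved s])).
  rewrite e /= lpermE => -[e'].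
  by have := lact_moved s; rewrite e' eqxx.
apply: symgP; elim=> [|p v IH]; rewrite symgE e //=.
rewrite !lpermE lactK /single (can2_eq (lactK s) (lactK s)).
by rewrite lact_lpt; case: eqP => // _; rewrite -symgE IH.
Qed.

(** * Free reduction and shortening of sections *)

Fixpoint repeats (w : word) : nat :=
  if w is s :: v then (ohead v == Some s) + repeats v else 0.

(** Cancelling a leading pair [s s] removes two letters and at most two adjacent repetitions, so
    each repetition costs at least one letter. *)
Lemma reduce w : exists u : word,
  [/\ forall t, good t -> ev t u = ev t w, size u + repeats w <= size w
    & repeats u = 0].
Proof.
have [n] := ubnP (size w); elim: n w => // n IH [|s w] /= szw; first by exists [::].
case: (eqVneq (ohead w) (Some s)) => [|ns].
  case: w szw => // s' w /= szw [->].
  have [u [eu su ru]] := IH w ltac:(lia).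
  exists u; split=> [t gt||//]; last by case: eqP => _ /=; lia.
  by rewrite eu // !ev_cons mulgA (gt s).2 mul1g.
have [u [eu su ru]] := IH w ltac:(lia).
case: (eqVneq (ohead u) (Some s)) => [|nu].
  case: u eu su ru => // s' u /= eu su ru [e]; rewrite {s'}e in eu ru *.
  exists u; split=> [t gt||]; [|lia..].
  by rewrite ev_cons -eu // ev_cons mulgA (gt s).2 mul1g.
exists (s :: u); split=> [t gt||] /=; [|lia|].
  by rewrite !ev_cons eu.
by rewrite (negbTE nu) ru.
Qed.

Lemma size_sec w p : size (sec w p) <= size w.
Proof.
elim: w p => //= s w IH p; rewrite size_cat.
by have := IH (lact s p); case: eqP => _ /=; lia.
Qed.

(** The first two letters differ, hence so do their points [lpt]. If the first letter goes to the
    section at p, it fixes p, and the second letter goes elsewhere; so one of the two is lost. *)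
Lemma size_sec_reduced w p :
  repeats w = 0 -> 1 < size w -> size (sec w p) < size w.
Proof.
case: w => [|s [|s' w]] //=; case: eqVneq => // -[ns] _ _; rewrite !size_cat.
have := size_sec w (lact s' (lact s p)).
case: (eqVneq p (lpt s)) => [->|_]; last by case: eqP => _ /=; lia.
rewrite lact_lpt; case: eqP => [/lpt_inj e|] /=; last by lia.
by rewrite e eqxx in ns.
Qed.

Lemma ev_eq1_tilde (w : word) n t :
  good t -> size w <= n.+1 ->
  (ev (iter n next_triple t) w = 1 <-> ev tilde w = 1).
Proof.
move=> gt.
have gi m := good_iter m gt.
elim: n w => [|n IH] w szw.
all: have [u [eu su ru]] := reduce w; rewrite -!eu //; try exact: good_tilde.
all: case: u {eu} su ru => [|s [|s' u]] su ru; rewrite ?ev_nil //.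
all: try by rewrite !ev_cons !ev_nil !mulg1; split=> /eqP;
  rewrite ?(negbTE (gi _ s).1) ?(negbTE (gt s).1) ?(negbTE (good_tilde s).1).
- by exfalso; rewrite /= in su; lia.
- set v := s :: s' :: u in su ru *.
  have eq1 t' : ev (next_triple t') v = 1 <->
      forall p, wact v p = p /\ ev t' (sec v p) = 1.
    have := ev_next_eq t' v [::]; rewrite !ev_nil => -[h1 h2].
    by split=> [/h1 h p|h]; [have := h p | apply: h2 => p; have := h p];
      rewrite /= ev_nil.
  (* The action [wact] on points is the same for both triples, so only the strictly shorter sections
     remain to be compared. *)
  rewrite -next_tilde; split=> /eq1 h; apply/eq1 => p; have [h1 h2] := h p;
    split=> //; apply/IH => //.
  all: have := size_sec_reduced p ru isT; lia.
Qed.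

(** * The local isomorphism *)

Lemma sym_gensE t g : good t ->
  sym_gens (triple_set t) g <-> exists s, g = tlet t s.
Proof.
move=> gt.
have inS h : triple_set t h <-> exists s, h = tlet t s.
  case: t {gt} => [[a b] c] /=; split=> [[[]|]->|[[] ->]] /=.
  - by exists X.
  - by exists Y.
  - by exists Z.
  - by left; left.
  - by left; right.
  - by right.
split=> [[/inS//|/inS[s e]]|]; last by left; apply/inS.
by exists s; rewrite -[g]invgK e tletV.
Qed.

Lemma word_ballE t n g : good t ->
  word_ball (triple_set t) n g <-> exists2 w : word, size w <= n & g = ev t w.
Proof.
move=> gt; split=> [[w [szw wS ->]]|[w szw ->]].
  suff [v sv ->] : exists2 v : word, size v = size w & \prod_(s <- w) s = ev t v.
    by exists v; rewrite ?sv.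
  elim: w wS {szw} => [|g' w IH] wS; first by exists [::]; rewrite // ev_nil big_nil.
  have [|v sv ev] := IH; first by move=> s sw; apply: wS; rewrite inE sw orbT.
  have [s ->] := (sym_gensE g' gt).1 (wS _ (mem_head _ _)).
  by exists (s :: v); rewrite /= ?sv // ev_cons big_cons ev.
exists (map (tlet t) w); split; rewrite ?size_map ?big_map //.
by move=> _ /mapP[s _ ->]; apply/sym_gensE => //; exists s.
Qed.

Lemma cayley_adjE t g h : good t ->
  cayley_adj (triple_set t) g h <-> exists s, h = g * tlet t s.
Proof.
move=> gt; split=> [[_ /(sym_gensE _ gt)[s ->] ->]|[s ->]]; first by exists s.
by exists (tlet t s) => //; apply/sym_gensE => //; exists s.
Qed.

Lemma ev_tilde_eq (w w' : word) n t :
  good t -> size w + size w' <= n.+1 ->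
  (ev (iter n next_triple t) w = ev (iter n next_triple t) w' <->
   ev tilde w = ev tilde w').
Proof.
move=> gt sz.
have gi := good_iter n gt.
have key t' : good t' -> (ev t' w = ev t' w' <-> ev t' (w ++ rev w') = 1).
  move=> gt'; rewrite ev_cat ev_rev //; split=> [->|e]; first exact: mulgV.
  by apply: (mulIg (ev t' w')^-1); rewrite e mulgV.
have szr : size (w ++ rev w') <= n.+1 by rewrite size_cat size_rev.
have := ev_eq1_tilde gt szr.
have := key _ gi; have := key _ good_tilde; tauto.
Qed.

Lemma local_iso (t : triple) r : good t -> exists2 n, (0 < n)%N
  & let Sn := triple_set (triple_seq t n) in
    induced_graph_iso (cayley_adj tilde_S) (word_ball tilde_S r)
                      (cayley_adj Sn) (word_ball Sn r).
Proof.
(* Adjacency compares a word of length r + 1 with one of length r; the total 2r + 1 is within the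
   bound m + 1 of [ev_tilde_eq]. *)
move=> gt; set m := (r + r).+1; exists m.+1 => //=.
rewrite /triple_seq /= -/m; set t' := iter m next_triple t.
have gt' : good t' := good_iter m gt.
(* A word of length at most r for g; the isomorphism evaluates the same word at [t']. The default is
   only taken outside the ball. *)
pose rp (g : symg (seq plane)) : word :=
  xget [::] [set w : word | size w <= r /\ g = ev tilde w]%classic.
have rpP g : word_ball tilde_S r g -> size (rp g) <= r /\ g = ev tilde (rp g).
  move/(word_ballE _ _ good_tilde) => [w sw ew].
  by apply: (@xgetPex _ [::] [set w : word | size w <= r /\ g = ev tilde w]%classic);
    exists w.
have iffE (w w' : word) : size w + size w' <= m.+1 ->
    (ev t' w = ev t' w' <-> ev tilde w = ev tilde w').
  exact: ev_tilde_eq.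
exists (fun g => ev t' (rp g)); first split.
- move=> g /rpP[sz _]; apply/word_ballE => //; by exists (rp g).
- move=> g h /set_mem/rpP[sg eg] /set_mem/rpP[sh eh] /iffE e.
  by rewrite eg eh; apply: e; rewrite /m; lia.
- move=> h /(word_ballE _ _ gt')[w sw ->].
  have /rpP[sg eg] : word_ball tilde_S r (ev tilde w).
    by apply/(word_ballE _ _ good_tilde); exists w.
  exists (ev tilde w); first by apply/(word_ballE _ _ good_tilde); exists w.
  by apply/iffE => //; rewrite /m; lia.
move=> u v /rpP[su eu] /rpP[sv ev'].
have adj (s : letter) : v = u * tlet tilde s <->
    ev t' (rp u) * tlet t' s = ev t' (rp v).
  rewrite [X in X <-> _](_ : _ =
    (ev tilde (rp u ++ [:: s]) = ev tilde (rp v))); last first.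
    rewrite ev_cat ev_cons ev_nil mulg1 -eu -ev'; apply/propext; split; exact: esym.
  rewrite -iffE; last by rewrite size_cat /m /=; lia.
  by rewrite ev_cat ev_cons ev_nil mulg1.
split=> [/(cayley_adjE _ _ good_tilde)|/(cayley_adjE _ _ gt')] [s e].
  by apply/cayley_adjE => //; exists s; apply: esym; apply/adj.
by apply/(cayley_adjE _ _ good_tilde); exists s; apply/adj; rewrite e.
Qed.

(** * Normal forms and balls *)

Fixpoint turns (w : word) : nat :=
  if w is s :: v then
    (if v is s1 :: s2 :: _ then (s1 == nextl s) && (s2 == s) else false) + turns v
  else 0.

Lemma turns_le_size w : turns w <= size w.
Proof.
elim: w => //= s w IH; rewrite -[in leqRHS]add1n leq_add //.
by case: w {IH} => // s1 [|s2 w] //; case: (_ && _).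
Qed.

Lemma sum_size_sec w : (\sum_p size (sec w p))%N = size w.
Proof.
elim: w => [|s w IH] /=; first by rewrite big1.
under eq_bigr do rewrite size_cat.
rewrite big_split /= -[RHS]/(1 + size w)%N -IH; congr (_ + _)%N.
  rewrite (bigD1 (lpt s)) //= eqxx big1 // => p /negbTE->; by [].
by rewrite [RHS](reindex_inj (inv_inj (lactK s))).
Qed.

(* As nextl s fixes lpt s, a factor s, nextl s, s contributes a factor s, s
   to the section at the point which the preceding letters move to lpt s. *)
Lemma turns_le_repeats w : turns w <= \sum_p repeats (sec w p).
Proof.
elim: w => [|s w IH] //=.
have -> : (\sum_p repeats ((if p == lpt s then [:: s] else [::]) ++ sec w (lact s p))
    = (ohead (sec w (lpt s)) == Some s) + \sum_p repeats (sec w p))%N.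
  rewrite [in RHS](reindex_inj (inv_inj (lactK s))) /=.
  rewrite (bigD1 (lpt s)) //= [in RHS](bigD1 (lpt s)) //= eqxx lact_lpt addnA.
  by congr (_ + _)%N; apply: eq_bigr => p /negbTE->.
apply: leq_add => //; case: w {IH} => [|s1 [|s2 w]] //.
case: (eqVneq s1 (nextl s)) => // ->; case: (eqVneq s2 s) => // -> /=.
by rewrite lact_nextl eqxx; case: s.
Qed.

(** A chosen geodesic word; the default is only taken for g not of the form [ev tilde v]. *)
Definition nf (g : symg (seq plane)) : word :=
  xget [::] [set w : word | ev tilde w = g /\
                            forall v, ev tilde v = g -> size w <= size v]%classic.

Lemma nfP (v : word) : ev tilde (nf (ev tilde v)) = ev tilde v /\
  forall u, ev tilde u = ev tilde v -> size (nf (ev tilde v)) <= size u.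
Proof.
apply: (@xgetPex _ [::] [set w : word | ev tilde w = ev tilde v /\
   forall u, ev tilde u = ev tilde v -> size w <= size u]%classic).
have [n] := ubnP (size v); elim: n v => // n IH v szv.
have [h|] := pselect (forall u, ev tilde u = ev tilde v -> size v <= size u).
  by exists v.
move=> /existsNP[u /not_implyP[eu /negP]]; rewrite -ltnNge => su.
by have [|w] := IH u; [lia | rewrite eu => h; exists w].
Qed.

Definition is_nf (w : word) : bool := nf (ev tilde w) == w.

Lemma is_nf_nf w : is_nf (nf (ev tilde w)).
Proof. by rewrite /is_nf (nfP w).1. Qed.

Lemma is_nf_repeats w : is_nf w -> repeats w = 0.
Proof.
move/eqP=> e; have [u [eu su _]] := reduce w.
by have := (nfP w).2 u (eu _ good_tilde); rewrite e; lia.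
Qed.

(** The sections share the letters of w, turns force repetitions in the sections, and reduction
    loses a letter for each repetition. *)
Lemma size_nf_sec w :
  (\sum_p size (nf (ev tilde (sec w p))) + turns w <= size w)%N.
Proof.
rewrite -[leqRHS](sum_size_sec w).
apply: leq_trans (leq_add (leqnn _) (turns_le_repeats w)) _.
rewrite -big_split /=; apply: leq_sum => p _.
have [u [eu su _]] := reduce (sec w p).
by have := (nfP (sec w p)).2 u (eu _ good_tilde); lia.
Qed.

(** * Enumeration of words and cardinality of balls *)

Fixpoint words n : seq word :=
  if n is m.+1 then [::] :: [seq s :: w | s <- letters, w <- words m] else [:: [::]].

Lemma mem_letters s : s \in letters. Proof. by case: s. Qed.

Lemma wordsS n :
  words n.+1 = [::] :: [seq s :: w | s <- letters, w <- words n].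
Proof. by []. Qed.

Lemma mem_words n w : (w \in words n) = (size w <= n).
Proof.
elim: n w => [|n IH] [|s w] //; rewrite wordsS in_cons // orFb [RHS]ltnS -IH.
apply/allpairsP/idP => [[[s' w'] /= [_ h [_ ->]]] //|h].
by exists (s, w); split=> //; apply: mem_letters.
Qed.

Lemma uniq_letters : uniq letters.
Proof. by []. Qed.

Lemma uniq_words n : uniq (words n).
Proof.
elim: n => // n IH; rewrite wordsS cons_uniq; apply/andP; split.
  by apply/allpairsP => -[[? ?] []].
by apply: allpairs_uniq uniq_letters IH _ => -[s w] [s' w'] _ _ [-> ->].
Qed.

Lemma card_fset_set_seq (T : choiceType) (A : set T) (l : seq T) :
  uniq l -> (forall x, A x <-> x \in l) -> #|` fset_set A|%fset = size l.
Proof.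
move=> ul Al; have -> : A = [set` l]%classic.
  by apply/seteqP; split=> x /= /Al.
apply: perm_size; apply: uniq_perm => // x.
have fl : finite_set [set` l]%classic by exact: finite_seq.
by rewrite (in_fset_set fl) mem_setE.
Qed.

Lemma ball_card_tilde n :
  ball_card tilde_S n = size [seq w <- words n | is_nf w].
Proof.
rewrite -(size_map (ev tilde)); apply: card_fset_set_seq.
  rewrite map_inj_in_uniq ?filter_uniq ?uniq_words // => w w'.
  by rewrite !mem_filter => /andP[/eqP nw _] /andP[/eqP nw' _] e; rewrite -nw -nw' e.
move=> g; split=> [/(word_ballE _ _ good_tilde)[w sw ->]|/mapP[w]].
  apply/mapP; exists (nf (ev tilde w)); last by rewrite (nfP w).1.
  rewrite mem_filter is_nf_nf mem_words.
  exact: leq_trans ((nfP w).2 _ erefl) sw.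
rewrite mem_filter mem_words => /andP[_ sw] ->.
by apply/(word_ballE _ _ good_tilde); exists w.
Qed.

Lemma ball_card_gt0 n : (0 < ball_card tilde_S n)%N.
Proof.
rewrite ball_card_tilde size_filter -has_count; apply/hasP.
exists (nf (ev tilde [::])); last exact: is_nf_nf.
by rewrite mem_words; apply: leq_trans ((nfP [::]).2 _ erefl) _.
Qed.

(** * Superpolynomial growth *)

(** A free reduction that computes, so that identities between concrete words are checked by
    evaluation. *)
Fixpoint cancel_word (w : word) : word :=
  if w is s :: v then
    let u := cancel_word v in
    if ohead u == Some s then behead u else s :: u
  else [::].

Lemma ev_cancel_word t w : good t -> ev t (cancel_word w) = ev t w.
Proof.
move=> gt; elim: w => //= s w IH; rewrite ev_cons -IH.
case: (cancel_word w) => [|s' u] /=; first by rewrite ev_cons.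
by case: eqP => [[->]|_]; rewrite !ev_cons // mulgA (gt s).2 mul1g.
Qed.

Lemma ev_cancel_eq t w w' : good t -> cancel_word w = w' -> ev t w = ev t w'.
Proof. by move=> gt <-; rewrite ev_cancel_word. Qed.

Lemma wact_cat u v p : wact (u ++ v) p = wact v (wact u p).
Proof. exact: foldl_cat. Qed.

Lemma sec_cat u v p : sec (u ++ v) p = sec u p ++ sec v (wact u p).
Proof. by elim: u p => //= s u IH p; rewrite IH catA. Qed.

Lemma wact_revK u p : wact (rev u) (wact u p) = p.
Proof.
by elim: u p => //= s u IH p; rewrite rev_cons -cats1 wact_cat IH /= lactK.
Qed.

Lemma sec_rev u p : sec (rev u) (wact u p) = rev (sec u p).
Proof.
elim: u p => //= s u IH p.
rewrite rev_cons -cats1 sec_cat IH wact_revK rev_cat /= cats0; congr (_ ++ _).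
by rewrite (can2_eq (lactK s) (lactK s)) lact_lpt; case: eqP.
Qed.

(* Words of even length are products of the elements s b, with b a fixed
   letter: (s t) = (s b) (t b)^-1. If A s has section s b at p, then lift A w
   has section w at p. *)
Fixpoint lift (A : letter -> word) (w : word) : word :=
  if w is s :: t :: v then A s ++ rev (A t) ++ lift A v else [::].

Lemma word2_ind (P : word -> Prop) :
  P [::] -> (forall s, P [:: s]) -> (forall s t w, P w -> P [:: s, t & w]) ->
  forall w, P w.
Proof.
move=> P0 P1 P2 w; have [n] := ubnP (size w); elim: n w => // n IH [|s [|t w]] //=.
by move=> szw; apply: P2; apply: IH; lia.
Qed.

Lemma wact_rev_fix u p : wact u p = p -> wact (rev u) p = p.
Proof. by move=> e; rewrite -{1}e wact_revK. Qed.

Lemma sec_rev_fix u p : wact u p = p -> sec (rev u) p = rev (sec u p).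
Proof. by move=> e; rewrite -{1}e sec_rev. Qed.

Lemma wact_lift A w p : (forall s, wact (A s) p = p) -> wact (lift A w) p = p.
Proof.
move=> A_fix; elim/word2_ind: w => //= s t w IH.
by rewrite !wact_cat A_fix wact_rev_fix.
Qed.

Lemma ev_sec_lift A b p : (forall s, wact (A s) p = p) ->
  (forall s, ev tilde (sec (A s) p) = ev tilde [:: s; b]) ->
  forall w, ~~ odd (size w) -> ev tilde (sec (lift A w) p) = ev tilde w.
Proof.
move=> A_fix hA; elim/word2_ind => //= s t w IH /=; rewrite negbK => /IH {}IH.
rewrite !sec_cat A_fix wact_rev_fix ?sec_rev_fix // !ev_cat.
rewrite ev_rev ?hA; last exact: good_tilde.
rewrite IH !ev_cons !ev_nil !mulg1 invgM tletV; last exact: good_tilde.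
rewrite tletV; last exact: good_tilde.
by rewrite -!mulgA [tlet tilde b * (_ * _)]mulgA (good_tilde b).2 mul1g.
Qed.

Lemma ev_sec_lift_eq1 A p : (forall s, wact (A s) p = p) ->
  (forall s, ev tilde (sec (A s) p) = 1) ->
  forall w, ev tilde (sec (lift A w) p) = 1.
Proof.
move=> A_fix hA; elim/word2_ind => //= [|s|s t w IH]; rewrite ?ev_nil //.
rewrite !sec_cat A_fix wact_rev_fix ?sec_rev_fix // !ev_cat.
rewrite ev_rev ?hA; last exact: good_tilde.
by rewrite IH invg1 !mulg1.
Qed.

Lemma size_lift A w : (forall s, size (A s) <= 12) -> size (lift A w) <= (12 * size w)%N.
Proof.
move=> sA; elim/word2_ind: w => //= s t w IH.
by rewrite !size_cat size_rev; have := sA s; have := sA t; lia.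
Qed.

Lemma odd_size_lift A w :
  (forall s, ~~ odd (size (A s))) -> ~~ odd (size (lift A w)).
Proof.
move=> sA; elim/word2_ind: w => //= s t w IH.
by rewrite !size_cat size_rev !oddD !(negbTE (sA _)).
Qed.

(* The words of lift1 have nontrivial sections only on the points of a line
   through 1, those of lift2 only on the points of a line through 2 that
   avoids 1. *)
Definition lift1 (s : letter) : word :=
  match s with
  | X => [:: X; Z; Y; Z; X; Z; Y; Z; X; Z; Y; Z]
  | Y => [::]
  | Z => [:: X; Z; X; Y; X; Z; X; Y; X; Z; X; Y]
  end.

Definition lift2 (s : letter) : word :=
  match s with
  | X => [:: Y; X; Y; Z; Y; X; Y; Z; Y; X; Y; Z]
  | Y => [:: X; Y; X; Z; X; Y; X; Z; X; Y; X; Z]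
  | Z => [::]
  end.

(** The nonempty words of [lift1] and [lift2] are cubes of four-letter words that act on the plane
    with order 3. *)
Lemma lift1_fix s p : wact (lift1 s) p = p.
Proof. by case: s => //; case: p => [[|[|[|[|[|[|[|?]]]]]]] ?] //; apply/val_inj. Qed.

Lemma lift2_fix s p : wact (lift2 s) p = p.
Proof. by case: s => //; case: p => [[|[|[|[|[|[|[|?]]]]]]] ?] //; apply/val_inj. Qed.

(** The fixed letter b of [lift] is Y here and Z for [lift2]; as b b = 1, the word of b itself can
    be empty. *)
Lemma lift1_sec1 s : ev tilde (sec (lift1 s) p1) = ev tilde [:: s; Y].
Proof.
case: s; [| by rewrite !ev_cons !ev_nil mulg1 (good_tilde Y).2 |];
  exact: (ev_cancel_eq good_tilde).
Qed.

Lemma lift2_sec2 s : ev tilde (sec (lift2 s) p2) = ev tilde [:: s; Z].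
Proof.
case: s; [| | by rewrite !ev_cons !ev_nil mulg1 (good_tilde Z).2];
  exact: (ev_cancel_eq good_tilde).
Qed.

Lemma lift2_sec1 s : ev tilde (sec (lift2 s) p1) = 1.
Proof. by rewrite -(ev_nil tilde); apply: (ev_cancel_eq good_tilde); case: s. Qed.

Fixpoint family k : seq word :=
  if k is j.+1 then
    [seq lift lift1 u ++ lift lift2 v | u <- family j, v <- family j]
  else [:: [::]; [:: X; Y]].

Lemma familyP k w : w \in family k -> size w <= (2 * 24 ^ k)%N /\ ~~ odd (size w).
Proof.
elim: k w => [|k IH] w; first by rewrite !inE => /orP[]/eqP->.
move=> /allpairsP[[u v] /= [/IH[su _] /IH[sv _] ->]]; rewrite size_cat oddD.
have s1 : size (lift lift1 u) <= (12 * size u)%N by apply: size_lift; case.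
have s2 : size (lift lift2 v) <= (12 * size v)%N by apply: size_lift; case.
rewrite (negbTE (odd_size_lift _ _)); last by case.
rewrite (negbTE (odd_size_lift _ _)); last by case.
by split=> //; rewrite expnS; lia.
Qed.

Lemma size_family k : size (family k) = (2 ^ 2 ^ k)%N.
Proof.
by elim: k => //= k IH; rewrite size_allpairs IH -expnD addnn -mul2n -expnS.
Qed.

(** At 1 the second factor has a trivial section and the first one gives u. Since [lift] is defined
    on words, the injectivity assumption is used to get u = u' as words and to cancel the first
    factor; the section at 2 then gives v. *)
Lemma ev_lift_inj u v u' v' :
  ~~ odd (size u) -> ~~ odd (size u') -> ~~ odd (size v) -> ~~ odd (size v') ->
  (ev tilde u = ev tilde u' -> u = u') ->
  ev tilde (lift lift1 u ++ lift lift2 v) = ev tilde (lift lift1 u' ++ lift lift2 v') ->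
  u = u' /\ ev tilde v = ev tilde v'.
Proof.
move=> ou ou' ov ov' inj e.
have [_ e1] := (ev_next_eq tilde _ _).1
  (eq_ind_r (fun t => ev t _ = ev t _) e next_tilde) p1.
have {inj e1} uu' : u = u'.
  apply: inj; move: e1; rewrite !sec_cat !(wact_lift _ (lift1_fix^~ _)).
  rewrite !ev_cat !(ev_sec_lift_eq1 (lift2_fix^~ _) lift2_sec1) !mulg1.
  by rewrite !(ev_sec_lift (lift1_fix^~ _) lift1_sec1).
split=> //; move: e; rewrite uu' !ev_cat => /mulgI e.
have [_] := (ev_next_eq tilde _ _).1
  (eq_ind_r (fun t => ev t _ = ev t _) e next_tilde) p2.
by rewrite !(ev_sec_lift (lift2_fix^~ _) lift2_sec2).
Qed.

Lemma family_inj k : {in family k &, injective (ev tilde)}.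
Proof.
elim: k => [|k IH].
  have ne : ev tilde [:: X; Y] <> ev tilde [::].
    move=> /(congr1 (fun g : symg (seq plane) => g [:: p1])).
    by rewrite -next_tilde !ev_next ev_nil => -[].
  by move=> u v; rewrite !inE => /orP[]/eqP-> /orP[]/eqP-> // e; case: ne.
move=> _ _ /allpairsP[[u v] /= [uF vF ->]] /allpairsP[[u' v'] /= [u'F v'F ->]] e.
have [-> evv] := ev_lift_inj (familyP uF).2 (familyP u'F).2 (familyP vF).2
  (familyP v'F).2 (IH _ _ uF u'F) e.
by rewrite (IH _ _ vF v'F evv).
Qed.

Lemma uniq_family k : uniq (family k).
Proof.
elim: k => // k IH; apply: allpairs_uniq => //.
move=> _ _ /allpairsP[[u v] /= [uF vF ->]] /allpairsP[[u' v'] /= [u'F v'F ->]] /= e.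
have [-> evv] := ev_lift_inj (familyP uF).2 (familyP u'F).2 (familyP vF).2
  (familyP v'F).2 (family_inj uF u'F) (congr1 (ev tilde) e).
by rewrite (family_inj vF v'F evv).
Qed.

Lemma ball_card_ge k : (2 ^ 2 ^ k <= ball_card tilde_S (2 * 24 ^ k))%N.
Proof.
rewrite ball_card_tilde -size_family -(size_map (fun w => nf (ev tilde w))).
apply: uniq_leq_size.
  rewrite map_inj_in_uniq ?uniq_family // => w w' wF w'F e.
  by apply: family_inj wF w'F _; rewrite -(nfP w).1 e (nfP w').1.
move=> _ /mapP[w wF ->]; rewrite mem_filter is_nf_nf mem_words.
exact: leq_trans ((nfP w).2 _ erefl) (familyP wF).1.
Qed.

Local Open Scope ring_scope.

(** * Comparison with polynomials *)

Lemma horner_le_pow (R : realType) (p : {poly R}) :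
  exists K : nat, forall n : nat, (0 < n)%N -> p.[n%:R] <= (K * n ^ size p)%:R.
Proof.
pose c := \sum_(i < size p) `|p`_i|.
exists (Num.bound c) => n n0; have c0 : 0 <= c by apply: sumr_ge0.
rewrite natrM natrX; apply: (@le_trans _ _ (c * n%:R ^+ size p)); last first.
  by rewrite ler_wpM2r ?exprn_ge0 // ltW // archi_boundP.
rewrite horner_coef mulr_suml; apply: ler_sum => i _.
apply: (@le_trans _ _ (`|p`_i| * n%:R ^+ i)).
  by rewrite ler_wpM2r ?exprn_ge0 // ler_norm.
by rewrite ler_wpM2l // ler_weXn2l ?ler1n // ltnW.
Qed.

Lemma leq_expn2 e a b : (a <= b)%N -> (a ^ e <= b ^ e)%N.
Proof. by case: e => // e ab; rewrite leq_exp2r. Qed.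

Lemma ball_card_not_polynomial (R : realType) :
  ~ exists p : {poly R}, forall n, (ball_card tilde_S n)%:R <= p.[n%:R].
Proof.
move=> [p hp]; have [K hK] := horner_le_pow p; set D := size p in hK.
have {hK}hp k : (2 ^ 2 ^ k <= K * (2 * 24 ^ k) ^ D)%N.
  apply: leq_trans (ball_card_ge k) _; rewrite -(ler_nat R).
  by apply: le_trans (hp _) (hK _ _); rewrite muln_gt0 expn_gt0.
(* Exponents are compared in base 2, with K <= 2^K and 24 <= 2^5. *)
have {}hp k : (2 ^ k <= K + (5 * k + 1) * D)%N.
  rewrite -(leq_exp2l (m := 2)) //; apply: leq_trans (hp k) _.
  rewrite expnD leq_mul ?(ltnW (ltn_expl _ _)) // expnM.
  by apply: leq_expn2; rewrite addn1 expnS leq_mul // expnM leq_expn2.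
(* At k = 2m the left side is q^2 with q = 2^m > m, and (m + 1)^2 exceeds K + (10m + 1) D. *)
have := hp ((K + 11 * D) * 2)%N; set m := (K + 11 * D)%N.
have := ltn_expl m (ltnSn 1); rewrite expnM.
move: (2 ^ m)%N => q mq; rewrite -mulnn; nia.
Qed.

(** * Subexponential growth *)

(** The finite type serves for injections and products over sections, the list for recursion on the
    first letter. *)
Lemma sum_words (R : realType) n (P : pred word) (F : word -> R) :
  \sum_(w : n.-bseq letter | P w) F w = \sum_(w <- words n | P w) F w.
Proof.
rewrite -(big_map val P F); apply: perm_big.
rewrite /index_enum -enumT; apply: uniq_perm; rewrite ?uniq_words //.
  by rewrite map_inj_uniq ?enum_uniq //; apply: val_inj.
move=> w; rewrite mem_words; apply/mapP/idP => [[u _ ->]|sw].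
  exact: size_bseq.
by exists (Bseq sw); rewrite ?mem_enum.
Qed.

Lemma sum_words_rec (R : realType) n (F : word -> R) :
  \sum_(w <- words n.+1) F w =
  F [::] + \sum_(w <- words n) \sum_(s <- letters) F (s :: w).
Proof. by rewrite wordsS big_cons big_allpairs_dep exchange_big. Qed.

(** A partial sum of Z(v), each element entering by its normal form; Z(v) < oo becomes a bound
    uniform in n. *)
Definition nfsum (R : realType) n (v : R) : R :=
  \sum_(w : n.-bseq letter | is_nf w) v ^- size w.

Definition nfsum_bounded (R : realType) (v : R) : Prop :=
  exists C, forall n, nfsum n v <= C.

Lemma nfsum_words (R : realType) n (v : R) :
  nfsum n v = \sum_(w <- words n | is_nf w) v ^- size w.
Proof. exact: (sum_words _ is_nf (fun w => v ^- size w)). Qed.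

(** Over all words, three letters of weight 1/4 give a geometric series of ratio 3/4, whose sum is
    4. *)
Lemma nfsum_bounded4 (R : realType) : nfsum_bounded (4 : R).
Proof.
exists 4 => n; rewrite nfsum_words.
apply: (@le_trans _ _ (\sum_(w <- words n) (4 : R) ^- size w)).
  rewrite big_mkcond /=; apply: ler_sum => w _.
  by case: ifP => // _; rewrite invr_ge0 exprn_ge0.
elim: n => [|n IH]; first by rewrite big_seq1 expr0 invr1; lra.
rewrite sum_words_rec expr0 invr1.
under eq_bigr => w _.
  rewrite !big_cons big_nil /= exprS invfM.
  rewrite (_ : _ + _ = 3 / 4 * 4 ^- size w); last by field.
  over.
rewrite -mulr_sumr; lra.
Qed.

Lemma nfsum_bounded_le (R : realType) (v v' : R) :
  0 < v -> v <= v' -> nfsum_bounded v -> nfsum_bounded v'.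
Proof.
move=> v0 vv' [C bC]; exists C => n; apply: le_trans (bC n).
apply: ler_sum => w _; rewrite lef_pV2 ?posrE ?exprn_gt0 ?(lt_le_trans v0) //.
by rewrite lerXn2r // nnegrE; lra.
Qed.

(** * Weighted count of reduced words by turns *)

Definition stepwt (R : realType) (r : R) (w : word) : R :=
  match w with
  | [::] => 3
  | [:: _] => 1
  | s :: s' :: _ => if s' == nextl s then 1 else r
  end.

Definition turnwt (R : realType) (q r : R) (w : word) : R :=
  if repeats w == 0%N then q ^+ size w * r ^+ 2 ^+ turns w else 0.

Lemma turnwt_ge0 (R : realType) (q r : R) w : 0 <= q -> 0 <= r -> 0 <= turnwt q r w.
Proof.
by move=> q0 r0; rewrite /turnwt; case: ifP => // _; rewrite mulr_ge0 ?exprn_ge0.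
Qed.

Lemma stepwt_ge (R : realType) (r : R) w : 0 <= r <= 1 -> r <= stepwt r w.
Proof. by move=> r01; case: w => [|s [|s' w]] /=; try case: eqP; lra. Qed.

(* With two-letter transitions recorded as forward (s, nextl s) or backward
   steps, stepwt is the eigenvector of the transfer matrix
   [[1, 1], [r^2, 1]], for the eigenvalue 1 + r. *)
Lemma turnwt_transfer (R : realType) (q r : R) w : 0 <= q -> 0 <= r ->
  \sum_(s <- letters) turnwt q r (s :: w) * stepwt r (s :: w)
    <= q * (1 + r) * (turnwt q r w * stepwt r w).
Proof.
move=> q0 r0; rewrite /letters !big_cons big_nil.
have turnwt_cons (s : letter) v : turnwt q r (s :: v) =
    if ohead v == Some s then 0 else
    q * turnwt q r v * r ^+ 2 ^+ (turns (s :: v) - turns v)%N.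
  have le_t : (turns v <= turns (s :: v))%N by exact: leq_addl.
  rewrite /turnwt [repeats (s :: v)]/= addn_eq0.
  move: (turns (s :: v)) le_t => t le_t.
  case: (ohead v == Some s) => //=; case: ifP => _; last by rewrite mulr0 mul0r.
  by rewrite -{1}(subnKC le_t) exprS exprD; ring.
rewrite !turnwt_cons; case: w => [|s1 [|s2 w]].
- rewrite /= /turnwt /= !expr0; nra.
- have := turnwt_ge0 [:: s1] q0 r0; move: (turnwt _ _ _) => T T0.
  by case: s1 => /=; rewrite !expr0; nra.
have [->|n12] := eqVneq s2 s1.
  have -> : turnwt q r [:: s1, s1 & w] = 0 by rewrite turnwt_cons /= eqxx.
  by rewrite !mulr0 !mul0r; do !case: ifP => _; lra.
rewrite [turns [:: X, _ & _]]/= [turns [:: Y, _ & _]]/= [turns [:: Z, _ & _]]/= !addnK.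
move: (turnwt_ge0 [:: s1, s2 & w] q0 r0); move: (turnwt _ _ _) => T T0.
have qT : 0 <= q * T by exact: mulr_ge0.
by case: s1 n12 => n12; case: s2 n12 => //= _; rewrite ?expr0 ?expr1; nra.
Qed.

(** The cost r^2 of a turn lowers the growth rate of reduced words from 2 to 1 + r. The sums
    weighted by [stepwt] satisfy S(n+1) <= 3 + q (1 + r) S(n); dividing by r, a lower bound of
    [stepwt], removes that weight. *)
Lemma sum_turnwt_le (R : realType) n (q r : R) :
  0 <= q -> 0 < r <= 1 -> q * (1 + r) < 1 ->
  \sum_(w <- words n) turnwt q r w <= 3 / (1 - q * (1 + r)) / r.
Proof.
move=> q0 /andP[r0 r1] qr.
have c0 : 0 < 1 - q * (1 + r) by rewrite subr_gt0.
rewrite ler_pdivlMr // mulr_suml.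
apply: (@le_trans _ _ (\sum_(w <- words n) turnwt q r w * stepwt r w)).
  apply: ler_sum => w _; rewrite ler_wpM2l ?turnwt_ge0 ?(ltW r0) //.
  by rewrite stepwt_ge // r1 (ltW r0).
have n0 : turnwt q r [::] * stepwt r [::] = 3 by rewrite /turnwt /= !expr0 !mul1r.
elim: n => [|n IH].
  rewrite big_seq1 n0 ler_pdivlMr //.
  by have := mulr_ge0 q0 (addr_ge0 ler01 (ltW r0)); lra.
rewrite sum_words_rec n0.
apply: le_trans (lerD (lexx _) _) _.
  by apply: ler_sum => w _; apply: turnwt_transfer => //; apply: ltW.
rewrite -mulr_sumr.
apply: le_trans (lerD (lexx _) (ler_wpM2l _ IH)) _.
  by rewrite mulr_ge0 // addr_ge0 // ltW.
by rewrite le_eqVlt; apply/orP; left; apply/eqP; field; rewrite gt_eqF.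
Qed.

(** * Coding an element of V by its sections *)

Lemma sum_injective_le (R : realType) (I J : finType) (P : pred I) (Q : pred J)
    (h : I -> J) (F : J -> R) :
  {in P &, injective h} -> (forall i, P i -> Q (h i)) ->
  (forall j, Q j -> 0 <= F j) ->
  \sum_(i | P i) F (h i) <= \sum_(j | Q j) F j.
Proof.
move=> hI hQ F0.
rewrite -(big_imset (A := P) F hI) /= [leRHS](bigID (mem (h @: P))) /=.
apply: (@le_trans _ _ (\sum_(j | Q j && (j \in h @: P)) F j)).
  rewrite le_eqVlt; apply/orP; left; apply/eqP; apply: eq_bigl => j.
  by apply/idP/andP => [jh|[]//]; split=> //; have /imsetP[i /hQ Qi ->] := jh.
by rewrite lerDl; apply: sumr_ge0 => j /andP[/F0].
Qed.

(** Geodesics of sections have length at most n, so [insub_bseq] never falls back on its default. *)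
Definition section_code n (w : n.-bseq letter) :
    {ffun plane -> plane} * {ffun plane -> n.-bseq letter} :=
  ([ffun p => wact w p], [ffun p => insub_bseq n (nf (ev tilde (sec w p)))]).

Lemma val_section_code n (w : n.-bseq letter) p :
  (section_code w).2 p = nf (ev tilde (sec w p)) :> word.
Proof.
rewrite ffunE /insub_bseq [LHS]val_insubd ifT //.
apply: leq_trans ((nfP (sec w p)).2 _ erefl) _.
exact: leq_trans (size_sec _ _) (size_bseq _).
Qed.

(** A normal form is recovered from its element, which is determined by its action on points and the
    values of its sections. *)
Lemma section_code_inj n :
  {in [pred w : n.-bseq letter | is_nf w] &, injective (@section_code n)}.
Proof.
move=> w w'; rewrite !inE => /eqP nw /eqP nw' e; apply: val_inj => /=.
rewrite -nw -nw' -next_tilde; congr nf; apply/ev_next_eq => p; split.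
  by have [/ffunP/(_ p)] := e; rewrite !ffunE.
rewrite -(nfP (sec w p)).1 -val_section_code e val_section_code.
exact: (nfP (sec w' p)).1.
Qed.

(** Extended from the image to all codes, the sum separates: a constant for the action on points and
    one factor [nfsum n v] per section. *)
Lemma sum_section_code (R : realType) n (v : R) : 0 < v ->
  \sum_(w : n.-bseq letter | is_nf w)
      \prod_p v ^- size ((section_code w).2 p)
    <= #|{ffun plane -> plane}|%:R * nfsum n v ^+ 7.
Proof.
move=> v0.
pose Q (c : {ffun plane -> plane} * {ffun plane -> n.-bseq letter}) :=
  c.2 \in ffun_on [pred u : n.-bseq letter | is_nf u].
apply: le_trans (sum_injective_le (Q := Q)
  (F := fun c => \prod_p v ^- size (c.2 p)) (@section_code_inj n) _ _) _.
- move=> w _; apply/ffun_onP => p; rewrite inE val_section_code.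
  exact: is_nf_nf.
- by move=> c _; apply: prodr_ge0 => p _; rewrite invr_ge0 exprn_ge0 // ltW.
rewrite -(pair_big xpredT (fun g => g \in ffun_on [pred u : n.-bseq letter | is_nf u])
  (fun _ g => \prod_p v ^- size (g p))) /=.
rewrite -(bigA_distr_big [pred u : n.-bseq letter | is_nf u]
  (fun _ u => v ^- size u)) /=.
by rewrite sumr_const prodr_const card_ord mulr_natl.
Qed.

Lemma turn_weight_eq (F : fieldType) (v m : F) k l t : v != 0 -> m != 0 ->
  (v ^+ (2 * k) / m ^+ (2 * k).+1) ^+ (l + t) * (v ^- k) ^+ 2 ^+ t =
  (v ^+ l / m ^+ (l + t)) ^+ (2 * k) * m ^- (l + t).
Proof.
move=> v0 m0; rewrite -[_ ^+ 2 ^+ t]exprM !exprMn !exprVn -!exprM.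
rewrite (_ : 2 * k * (l + t) = l * (2 * k) + k * (2 * t))%N; last by lia.
rewrite (_ : (2 * k).+1 * (l + t) = (l + t) * (2 * k) + (l + t))%N; last by lia.
rewrite (exprD v) (exprD m _ (l + t)%N).
have := expf_neq0 (k * (2 * t)) v0; have := expf_neq0 ((l + t) * (2 * k)) m0.
have := expf_neq0 (l + t) m0.
move: (m ^+ _) (m ^+ _) (v ^+ _) (v ^+ _) => a b c d a0 b0 d0.
by field; rewrite a0 b0 d0.
Qed.

(* If the first term is smaller than m^-|w| then v^l > m^|w|, where l is
   |w| - turns w, while the second term is (v^l / m^|w|)^(2k) m^-|w|. *)
Lemma nf_weight_split (R : realType) k (v m : R) n (w : n.-bseq letter) :
  1 < v -> 0 < m -> is_nf w ->
  m ^- size w <= \prod_p v ^- size ((section_code w).2 p) +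
                 turnwt (v ^+ (2 * k) / m ^+ (2 * k).+1) (v ^- k) w.
Proof.
move=> v1 m0 nw; have v0 : 0 < v by lra.
have [l le_l] : exists l, (l + turns w = size w)%N.
  by exists (size w - turns w)%N; rewrite subnK // turns_le_size.
have tw0 : 0 <= turnwt (v ^+ (2 * k) / m ^+ (2 * k).+1) (v ^- k) w.
  by rewrite turnwt_ge0 ?divr_ge0 ?invr_ge0 ?exprn_ge0 // ltW.
have prod_le : v ^- l <= \prod_p v ^- size ((section_code w).2 p).
  under eq_bigr do rewrite val_section_code -exprVn.
  rewrite prodrXr -exprVn ler_wiXn2l ?invr_ge0 ?invf_le1 ?(ltW v0) ?(ltW v1) //.
  by have := size_nf_sec w; rewrite -le_l leq_add2r.
have [le_m|lt_m] := leP (m ^+ size w)^-1 (v ^+ l)^-1; first by lra.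
have {}lt_m : m ^+ size w <= v ^+ l.
  by move: lt_m; rewrite ltf_pV2 ?posrE ?exprn_gt0 // => /ltW.
have prod0 : 0 <= \prod_p v ^- size ((section_code w).2 p).
  by apply: prodr_ge0 => p _; rewrite invr_ge0 exprn_ge0 // ltW.
apply: le_trans _ (lerD prod0 (lexx _)); rewrite add0r /turnwt is_nf_repeats //=.
rewrite -le_l in lt_m *; set t := turns w in lt_m *.
rewrite turn_weight_eq ?gt_eqF //.
have ml0 : 0 < m ^+ (l + t) by rewrite exprn_gt0.
rewrite -[leLHS]mul1r ler_wpM2r ?invr_ge0 ?(ltW ml0) //.
by rewrite exprn_ege1 // ler_pdivlMr // mul1r.
Qed.

(** By [nf_weight_split], Z(m) is at most a multiple of Z(v)^7 plus a sum of turn weights. *)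
Lemma nfsum_bounded_step (R : realType) k (v m : R) :
  1 < v -> 0 < m -> v ^+ (2 * k) + v ^+ k < m ^+ (2 * k).+1 ->
  nfsum_bounded v -> nfsum_bounded m.
Proof.
move=> v1 m0 vm [C bC]; have v0 : 0 < v by lra.
have vk0 : 0 < v ^+ k by rewrite exprn_gt0.
pose q := v ^+ (2 * k) / m ^+ (2 * k).+1; pose r := v ^- k.
have q0 : 0 <= q by rewrite divr_ge0 // exprn_ge0 // ltW.
have r01 : 0 < r <= 1.
  by rewrite invr_gt0 vk0 invf_le1 //= exprn_ege1 // ltW.
(* This is the hypothesis on v and m, divided by m^(2k+1). *)
have qr : q * (1 + r) < 1.
  rewrite /q /r mulrAC ltr_pdivrMr ?exprn_gt0 // mul1r.
  by rewrite mulrDr mulr1 mul2n -addnn exprD mulfK ?gt_eqF // -exprD addnn -mul2n.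
exists (#|{ffun plane -> plane}|%:R * C ^+ 7 + 3 / (1 - q * (1 + r)) / r) => n.
have nf0 : 0 <= nfsum n v.
  by apply: sumr_ge0 => w _; rewrite invr_ge0 exprn_ge0 // ltW.
have C7 : nfsum n v ^+ 7 <= C ^+ 7.
  by apply: lerXn2r; rewrite ?nnegrE ?(le_trans nf0).
apply: (@le_trans _ _ (#|{ffun plane -> plane}|%:R * nfsum n v ^+ 7 +
    \sum_(w <- words n) turnwt q r w)); last first.
  by rewrite lerD ?ler_wpM2l // sum_turnwt_le.
apply: le_trans (lerD (sum_section_code n v0) (lexx _)).
rewrite -(sum_words n xpredT (turnwt q r)).
apply: (@le_trans _ _ (\sum_(w : n.-bseq letter | is_nf w)
    (\prod_p v ^- size ((section_code w).2 p) + turnwt q r w))).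
  by apply: ler_sum => w nw; apply: nf_weight_split.
rewrite big_split lerD2l /= big_mkcond /=.
apply: ler_sum => w _; case: ifP => // _.
by rewrite turnwt_ge0 // ltW //; case/andP: r01.
Qed.

(** * Descent from Z(4) to Z(1 + e) *)

Lemma bernoulli_le (R : realType) n (x : R) : -1 <= x -> 1 + n%:R * x <= (1 + x) ^+ n.
Proof.
move=> x1; elim: n => [|n IH]; first by rewrite expr0 mul0r addr0.
have n0 : 0 <= n%:R :> R by exact: ler0n.
rewrite exprS -natr1; apply: le_trans (ler_wpM2l _ IH); last by lra.
by have := mulr_ge0 n0 (sqr_ge0 x); rewrite expr2; lra.
Qed.

Lemma exists_nat_ge (R : realType) (x c : R) : 0 < c -> exists n : nat, x <= n%:R * c.
Proof.
move=> c0; exists (Num.bound `|x / c|).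
rewrite -ler_pdivrMr //.
by apply: le_trans (ler_norm _) (ltW (archi_boundP (normr_ge0 _))).
Qed.

(** Z(4) is finite, and finiteness passes from v to v (1 - d), with a fixed d, as long as 1 + e <= v
    <= 4. *)
Lemma nfsum_bounded_all (R : realType) (e : R) : 0 < e -> nfsum_bounded (1 + e).
Proof.
move=> e0; have [e4|e4] := leP 4 (1 + e).
  by apply: nfsum_bounded_le e4 (nfsum_bounded4 R); lra.
(* Then v^k (v - 1) >= 2 for all v >= 1 + e, which makes the gain 1 - d
   uniform on [1 + e, 4]. *)
have [k ke] : exists k, 2 <= (1 + e) ^+ k * e.
  have [k hk] := exists_nat_ge 2 (mulr_gt0 e0 e0).
  exists k; apply: le_trans hk _; rewrite mulrA ler_wpM2r ?(ltW e0) //.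
  by apply: le_trans _ (bernoulli_le k _); lra.
(* For v <= 4 this gives (2k + 1) d v^(k+1) < 1. By Bernoulli, (v (1 - d))^(2k+1) > v^(2k+1) - v^k,
   which is at least v^(2k) + v^k because v^k (v - 1) >= 2. *)
pose d : R := ((2 * k).+2%:R * 4 ^+ k.+1)^-1.
have D0 : 0 < (2 * k).+2%:R * 4 ^+ k.+1 :> R by rewrite mulr_gt0 ?exprn_gt0.
have d0 : 0 < d by rewrite invr_gt0.
have d1 : d <= 1 / 2.
  rewrite /d -[leLHS]mul1r ler_pdivrMr //.
  have : 1 <= 4 ^+ k.+1 :> R by apply: exprn_ege1; lra.
  have : 2 <= (2 * k).+2%:R :> R by rewrite ler_nat.
  by nra.
have step v : 1 + e <= v -> v <= 4 -> nfsum_bounded v -> nfsum_bounded (v * (1 - d)).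
  move=> ve v4; apply: (@nfsum_bounded_step _ k); [lra|by rewrite mulr_gt0; lra|].
  rewrite exprMn; have := bernoulli_le (2 * k).+1 (_ : - 1 <= - d) => /(_ ltac:(lra)).
  have : (2 * k).+1%:R * d * v ^+ k.+1 < 1.
    rewrite /d mulrAC ltr_pdivrMr // mul1r.
    have : (2 * k).+1%:R < (2 * k).+2%:R :> R by rewrite ltr_nat.
    have : 0 < v ^+ k.+1 by rewrite exprn_gt0 //; lra.
    have : v ^+ k.+1 <= 4 ^+ k.+1 by apply: lerXn2r; rewrite ?nnegrE //; lra.
    have : 0 <= (2 * k).+1%:R :> R by [].
    nra.
  have : (1 + e) ^+ k <= v ^+ k by apply: lerXn2r; rewrite ?nnegrE //; lra.
  rewrite !exprS mul2n -addnn (exprD v); have : 1 <= (1 + e) ^+ k.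
    by rewrite exprn_ege1 //; lra.
  move: (v ^+ k) ((1 + e) ^+ k) ke ((k + k).+1%:R) ((1 - d) * _)
    => a b ke n u b1 ab nd bu.
  have a0 : 0 < a by lra.
  have a2 : 2 <= a * (v - 1) by apply: le_trans ke _; rewrite [leRHS]mulrBr mulr1; nra.
  have aa : 0 < a * a * v by rewrite !mulr_gt0 //; lra.
  have := ler_wpM2l (ltW aa) bu; have := ler_wpM2l (ltW a0) a2.
  have : a * (n * d * (v * a)) < a * 1 by rewrite ltr_pM2l.
  lra.
(* If Z(1 + e) were infinite, no value reached could be at most 1 + e, and the descent would never
   stop. *)
apply: contrapT => nb.
have all_pow j : nfsum_bounded (4 * (1 - d) ^+ j).
  elim: j => [|j IH]; first by rewrite expr0 mulr1; apply: nfsum_bounded4.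
  have pj : 0 < (1 - d) ^+ j <= 1.
    by rewrite exprn_gt0 ?exprn_ile1 //; lra.
  have [lej|/ltW lej] := leP (4 * (1 - d) ^+ j) (1 + e).
    by case: nb; apply: nfsum_bounded_le lej IH; lra.
  by rewrite exprSr mulrA; apply: step => //; lra.
(* From j d >= 4 follow (1 + d)^j >= 5 and (1 - d)^j <= 1/5, so 4 (1 - d)^j < 1 + e. *)
have [j hj] := exists_nat_ge 4 d0.
apply: nb; apply: nfsum_bounded_le (all_pow j).
  by rewrite mulr_gt0 ?exprn_gt0 //; lra.
have pj : 0 < (1 - d) ^+ j by rewrite exprn_gt0 //; lra.
have : (1 - d) ^+ j * (1 + d) ^+ j <= 1.
  by rewrite -exprMn exprn_ile1 //; nra.
have := bernoulli_le j (_ : -1 <= d) => /(_ ltac:(lra)).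
nra.
Qed.

Lemma ball_card_le (R : realType) n (v : R) : 1 <= v ->
  (ball_card tilde_S n)%:R <= v ^+ n * nfsum n v.
Proof.
move=> v1; rewrite ball_card_tilde size_filter -sum1_count natr_sum nfsum_words mulr_sumr.
rewrite big_seq_cond [leRHS]big_seq_cond; apply: ler_sum => w /andP[+ _].
rewrite mem_words => sw.
by rewrite ler_pdivlMr ?exprn_gt0 ?mul1r ?ler_weXn2l //; lra.
Qed.

Lemma ball_card_subexponential (R : realType) (e : R) : 0 < e ->
  exists N, forall n, (N <= n)%N -> (ball_card tilde_S n)%:R <= (1 + e) ^+ n.
Proof.
move=> e0; have e20 : 0 < e / 2 by lra.
have [C bC] := nfsum_bounded_all e20.
(* The rate 1 + e is split as (1 + e/2) (1 + c), so that (1 + c)^n absorbs the constant C. *)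
pose c := e / 2 / (1 + e / 2); have c0 : 0 < c by rewrite divr_gt0 //; lra.
have ec : 1 + e = (1 + e / 2) * (1 + c) by rewrite /c; field; rewrite gt_eqF //; lra.
have [N hN] := exists_nat_ge C c0; exists N => n Nn.
apply: le_trans (ball_card_le n (_ : 1 <= 1 + e / 2)) _; first by lra.
rewrite ec exprMn ler_wpM2l ?exprn_ge0 //; first by lra.
apply: le_trans (bC n) _; apply: le_trans hN _.
apply: le_trans _ (bernoulli_le n (_ : -1 <= c)); last by lra.
have : N%:R * c <= n%:R * c by rewrite ler_wpM2r ?ler_nat // ltW.
by lra.
Qed.

Lemma growth_rate_tilde (R : realType) :
  ((fun n => ((ball_card tilde_S n)%:R `^ n%:R^-1)%R) @ \oo --> (1%R : R))%classic.
Proof.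
apply/cvgrPdist_le => e e0.
have [N hN] := ball_card_subexponential e0.
exists N.+1 => // n /= Nn.
have b1 : 1 <= (ball_card tilde_S n)%:R :> R by rewrite ler1n ball_card_gt0.
have n0 : (n%:R : R) != 0 by rewrite pnatr_eq0; lia.
have i0 : 0 <= n%:R^-1 :> R by rewrite invr_ge0.
have ge1 : 1 <= (ball_card tilde_S n)%:R `^ n%:R^-1 :> R.
  rewrite [leLHS](_ : 1 = 1 `^ n%:R^-1); last by rewrite powR1.
  by apply: ge0_ler_powR; rewrite ?nnegrE //; lra.
have le1e : (ball_card tilde_S n)%:R `^ n%:R^-1 <= 1 + e.
  apply: (@le_trans _ _ (((1 + e) ^+ n) `^ n%:R^-1)).
    apply: ge0_ler_powR; rewrite ?nnegrE ?exprn_ge0 ?hN //; by [lra | lia].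
  by rewrite -powR_mulrn -?powRrM ?mulfV ?powRr1 //; lra.
by rewrite ler_norml; lra.
Qed.

Theorem theorem3p1 (R : realType) :
  intermediate_growth R V_group tilde_S /\
  forall a b c : symg (seq plane),
    involution a -> involution b -> involution c ->
    gen_subgroup (triple_set (a, b, c)) = W_group ->
    forall r : nat, exists2 n : nat, (0 < n)%N
      & let Sn := triple_set (triple_seq (a, b, c) n) in
        induced_graph_iso (cayley_adj tilde_S) (word_ball tilde_S r)
                          (cayley_adj Sn) (word_ball Sn r).
Proof.
split; last by move=> a b c ia ib ic _ r; apply: local_iso; case.
split=> //; last exact: ball_card_not_polynomial.
- by rewrite /tilde_S /= !finite_setU; do !split; apply: finite_set1.
- exact: growth_rate_tilde.
Qed.
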